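(* Let $a$ and $n$ be positive integers and let $S=\{x_1,\dots,x_n\}$ be a gcd closed set of $n$ distinct positive integers satisfying condition $\mathcal{G}$, with $\gcd(x_1,\dots,x_n)=1$ and indexed so that $x_1=1$. For each $i$ write $G_S(x_i)=\{y^i_1,\dots,y^i_{l_i}\}$ with $l_i=|G_S(x_i)|$. Let $B_S$ be the $n\times n$ matrix whose $(i,j)$-entry is $\mu_{x_j}\left(\frac{x_j}{x_i}\right)$ if $x_i\mid x_j$ and $0$ otherwise, and let $B_{S^a}$ be the $n\times n$ matrix whose $(i,j)$-entry is $\mu_{x_j}\left(\frac{x_j}{x_i}\right)\left(\frac{x_j}{x_i}\right)^a$ if $x_i\mid x_j$ and $0$ otherwise. Then $$B_S^T\big((x_i,x_j)^a\big)B_S=\operatorname{diag}\Big(1,\ (y^2_1,\dots,y^2_{l_2})^a\prod_{h=1}^{l_2}\Big(\Big(\frac{x_2}{y^2_h}\Big)^a-1\Big),\ \dots,\ (y^n_1,\dots,y^n_{l_n})^a\prod_{h=1}^{l_n}\Big(\Big(\frac{x_n}{y^n_h}\Big)^a-1\Big)\Big)$$ and $$B_{S^a}^T\big([x_i,x_j]^a\big)B_{S^a}=\operatorname{diag}\Big(1,\ x_2^a\prod_{h=1}^{l_2}\Big(1-\Big(\frac{x_2}{y^2_h}\Big)^a\Big),\ \dots,\ x_n^a\prod_{h=1}^{l_n}\Big(1-\Big(\frac{x_n}{y^n_h}\Big)^a\Big)\Big).$$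
   Context: $(x,y)$ (and $(y_1,\dots,y_k)$) denotes the greatest common divisor and $[x,y]$ the least common multiple; $((x_i,x_j)^a)$ and $([x_i,x_j]^a)$ denote the $n\times n$ matrices with $(i,j)$-entries $(x_i,x_j)^a$ and $[x_i,x_j]^a$. A set $S$ is gcd closed if $(x,y)\in S$ for all $x,y\in S$. For $x\in S$, an element $y\in S$ is a greatest-type divisor of $x$ in $S$ if $y\mid x$, $y<x$, and whenever $d\in S$ with $y\mid d\mid x$ then $d\in\{y,x\}$; $G_S(x)$ is the set of greatest-type divisors of $x$ in $S$. The set $S$ satisfies condition $\mathcal{G}$ if for every $x\in S$ with $|G_S(x)|\ge 2$ and any two distinct $y_1,y_2\in G_S(x)$ one has $[y_1,y_2]=x$ and $(y_1,y_2)\in G_S(y_1)\cap G_S(y_2)$. For $x\in S$ with $G_S(x)=\{y_1,\dots,y_k\}$, the imitative Möbius function $\mu_x$ on positive integers is defined by $\mu_x(1)=1$; $\mu_x(t)=(-1)^j$ if $t=\prod_{r=1}^{j}\frac{x}{y_{i_r}}$ for some $j\ge1$ distinct indices $i_1,\dots,i_j\in\{1,\dots,k\}$; and $\mu_x(t)=0$ otherwise. *)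

(* Defs.v *)
From HB Require Import structures.
From mathcomp Require Import all_boot all_order all_algebra finmap.

Set Implicit Arguments.
Unset Strict Implicit.
Unset Printing Implicit Defensive.

Import GRing.Theory.

Local Open Scope fset_scope.
Local Open Scope nat_scope.

Definition gcd_closed (S : {fset nat}) : Prop :=
  forall x y, x \in S -> y \in S -> gcdn x y \in S.

Definition greatest_type_divisors (S : {fset nat}) (x : nat) : {fset nat} :=
  [fset y in S | [&& y %| x, y < x &
     [forall d : S, (y %| val d) && (val d %| x) ==>
                    ((val d == y) || (val d == x))]]].

Definition conditionG (S : {fset nat}) : Prop :=
  forall x, x \in S -> 2 <= #|` greatest_type_divisors S x| ->
  forall y1 y2,
    y1 \in greatest_type_divisors S x -> y2 \in greatest_type_divisors S x ->
    y1 != y2 ->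
    lcmn y1 y2 = x /\
    gcdn y1 y2 \in greatest_type_divisors S y1 `&` greatest_type_divisors S y2.

(* The sets A of j >= 1 greatest-type divisors of x stand for the choices of
   j distinct indices. For an arbitrary S, products over different sets A may
   coincide and the value then depends on which one [pick] selects; under
   conditionG the set A is determined by t, see imitative_mobius_prod. *)
Definition imitative_mobius (S : {fset nat}) (x t : nat) : int :=
  if t == 1 then 1%R
  else if [pick A : {set greatest_type_divisors S x} |
             (A != set0) && (t == \prod_(y in A) (x %/ val y))] is Some A
       then ((-1) ^+ #|A|)%R
       else 0%R.

Lemma imitative_mobius_prod (S : {fset nat}) (x : nat)
    (A : {set greatest_type_divisors S x}) :
  conditionG S -> x \in S -> 0 < x -> A != set0 ->
  imitative_mobius S x (\prod_(y in A) (x %/ val y)) = ((-1) ^+ #|A|)%R.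
Proof.
move=> GS xS x0 An0.
have dP (y : greatest_type_divisors S x) :
    [/\ val y %| x, val y < x & 0 < val y].
  have := valP y; rewrite !inE /= => /andP[_ /and3P[yx yltx _]].
  by split=> //; exact: dvdn_gt0 yx.
have d1 (y : greatest_type_divisors S x) : 1 < x %/ val y.
  by have [yx yltx y0] := dP y; rewrite ltn_divRL // mul1n.
have cop (y z : greatest_type_divisors S x) :
    y != z -> coprime (x %/ val y) (x %/ val z).
  move=> yz; have [yx _ y0] := dP y; have [zx _ z0] := dP z.
  have vyz : val y != val z by [].
  have card2 : 2 <= #|` greatest_type_divisors S x|.
    rewrite (cardfsD1 (val y)) (valP y) (cardfsD1 (val z)) !inE eq_sym vyz /=.
    by have := valP z; rewrite !inE /= => ->.
  have [lx _] := GS x xS card2 _ _ (valP y) (valP z) vyz.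
  set g := gcdn (x %/ val y) (x %/ val z).
  have g0 : 0 < g by rewrite gcdn_gt0 (ltnW (d1 y)).
  have dvg (u : nat) : u %| x -> 0 < u -> g %| x %/ u -> u %| x %/ g.
    move=> ux u0 /dvdnP[q Eq]; apply/dvdnP; exists q.
    by rewrite -[X in X %/ g](divnK ux) Eq mulnAC mulnK.
  have gx : g %| x.
    by apply: dvdn_trans (dvdn_gcdl _ _) _; exact: dvdn_div.
  have : x %| x %/ g.
    rewrite -[X in X %| _]lx dvdn_lcm !dvg //.
      exact: dvdn_gcdr.
    exact: dvdn_gcdl.
  move/dvdn_leq; rewrite divn_gt0 // (dvdn_leq x0 gx) => /(_ isT).
  rewrite leq_divRL //.
  by rewrite -[X in _ <= X]muln1 leq_pmul2l // => h; rewrite /coprime eqn_leq h.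
have subAB (A1 A2 : {set greatest_type_divisors S x}) :
    \prod_(y in A1) (x %/ val y) = \prod_(y in A2) (x %/ val y) ->
    A1 \subset A2.
  move=> E; apply/subsetP => y yA; apply/negPn/negP => yB.
  have : coprime (x %/ val y) (\prod_(y in A2) (x %/ val y)).
    apply: (big_ind (coprime _)) => [|u v cu cv|z zB]; first exact: coprimen1.
      by rewrite coprimeMr cu.
    by apply: cop; apply: contraNneq yB => ->.
  rewrite -E (bigD1 y) //= coprimeMr /coprime gcdnn => /andP[/eqP H _].
  by have := d1 y; rewrite H.
rewrite /imitative_mobius; case: ifPn => [/eqP E|_].
  have : A \subset set0 by apply: subAB; rewrite E big_set0.
  by rewrite subset0 (negPf An0).
case: pickP => [B /andP[_ /eqP E]|/(_ A)]; last by rewrite An0 eqxx.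
by congr (_ ^+ _)%R; congr #|pred_of_set _|; apply/eqP;
   rewrite eqEsubset !subAB.
Qed.

Local Open Scope ring_scope.

Definition power_gcd_mx (n : nat) (x : 'I_n -> nat) (a : nat) : 'M[int]_n :=
  \matrix_(i, j) (gcdn (x i) (x j))%:Z ^+ a.

Definition power_lcm_mx (n : nat) (x : 'I_n -> nat) (a : nat) : 'M[int]_n :=
  \matrix_(i, j) (lcmn (x i) (x j))%:Z ^+ a.

Definition B_mx (S : {fset nat}) (n : nat) (x : 'I_n -> nat) : 'M[int]_n :=
  \matrix_(i, j)
    if (x i %| x j)%N then imitative_mobius S (x j) (x j %/ x i)%N else 0.

(* The Moebius factor is taken with respect to S, not to the set of
   a-th powers *)
Definition B_pow_mx (S : {fset nat}) (n : nat) (x : 'I_n -> nat) (a : nat) :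
    'M[int]_n :=
  \matrix_(i, j)
    if (x i %| x j)%N
    then imitative_mobius S (x j) (x j %/ x i)%N * (x j %/ x i)%N%:Z ^+ a
    else 0.

(* Main.v *)
(* For x in S write c_y = x / y for y in G_S(x). Condition G makes the c_y
   pairwise coprime, so gcd(A) = x / \prod_(y in A) c_y for every nonempty
   subset A of G_S(x), and a sum over d | x in S weighted by mu_x(x/d) becomes
   the sum over all A of (-1)^|A| times the term at x / \prod_(y in A) c_y.
   If z in S is not a multiple of x, then gcd(z, x) divides some y in G_S(x);
   adding y to A does not change gcd(z, x / \prod_(y in A) c_y), so the sum of
   any function of gcd(z, d) cancels in pairs. Hence the (i, j)-entry of M B
   vanishes unless x_j | x_i, while that of B vanishes unless x_i | x_j; as M is
   symmetric, B^T M B is diagonal. On the diagonal the alternating sum factors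
   into a product over G_S(x). The lcm case is the same since
   (x/d) lcm(z, d) = z x / gcd(z, d). *)
Require Import Defs.
From HB Require Import structures.
From mathcomp Require Import all_boot all_order all_algebra finmap.

Set Implicit Arguments.
Unset Strict Implicit.
Unset Printing Implicit Defensive.

Import GRing.Theory.

Local Open Scope fset_scope.
Local Open Scope ring_scope.

(** * Products of pairwise coprime divisors *)

Section PairwiseCoprime.
Local Open Scope nat_scope.

(** With x = k m n, the two quotients are k n and k m, whose gcd is k. *)
Lemma gcdn_div_coprime (m n x : nat) :
  0 < x -> coprime m n -> m %| x -> n %| x ->
  gcdn (x %/ m) (x %/ n) = x %/ (m * n).
Proof.
move=> x0 cmn mx nx.
have /dvdnP[k Ek] : m * n %| x by rewrite Gauss_dvd // mx nx.
move: x0; rewrite Ek !muln_gt0 => /and3P[_ m0 n0].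
rewrite mulnK ?muln_gt0 ?m0 // mulnA mulnK // mulnAC mulnK //.
by rewrite -muln_gcdr gcdnC (eqP cmn) muln1.
Qed.

Lemma coprime_prod_set (I : finType) (c : I -> nat) (i : I) (A : {set I}) :
  {in A, forall j, coprime (c i) (c j)} -> coprime (c i) (\prod_(j in A) c j).
Proof.
move=> cA; apply: (big_ind (coprime (c i))) => [|u v cu cv|j /cA //].
  exact: coprimen1.
by rewrite coprimeMr cu.
Qed.

Lemma set_ind (I : finType) (P : {set I} -> Prop) :
  P set0 -> (forall (i : I) (A : {set I}), i \notin A -> P A -> P (i |: A)) ->
  forall A, P A.
Proof.
move=> P0 PU A; have [m] := ubnP #|A|; elim: m A => // m IH A.
have [-> //|[i iA]] := set_0Vmem A.
rewrite (cardsD1 i) iA add1n ltnS => Am.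
by rewrite -(setD1K iA); apply: PU (IH _ Am); rewrite !inE eqxx.
Qed.

Lemma dvdn_prod_coprime (I : finType) (c : I -> nat) (x : nat) :
  (forall i, c i %| x) -> (forall i j, i != j -> coprime (c i) (c j)) ->
  forall A : {set I}, \prod_(i in A) c i %| x.
Proof.
move=> cx cc; apply: set_ind => [|i A iA IH]; first by rewrite big_set0 dvd1n.
rewrite big_setU1 //= Gauss_dvd ?cx //.
by apply: coprime_prod_set => j jA; apply: cc; apply: contraNneq iA => ->.
Qed.

(** A factor [c i] > 1 of one product is coprime to any product that omits i, so it cannot divide
    the latter. *)
Lemma prod_coprime_inj (I : finType) (c : I -> nat) :
  (forall i, 1 < c i) -> (forall i j, i != j -> coprime (c i) (c j)) ->
  injective (fun A : {set I} => \prod_(i in A) c i).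
Proof.
move=> c1 cc; suff sub (A B : {set I}) :
    \prod_(i in A) c i = \prod_(i in B) c i -> A \subset B.
  by move=> A B E; apply/eqP; rewrite eqEsubset !sub.
move=> E; apply/subsetP => i iA; apply/negPn/negP => iB.
have : coprime (c i) (\prod_(i in B) c i).
  by apply: coprime_prod_set => j jB; apply: cc; apply: contraNneq iB => ->.
rewrite -E (bigD1 i) //= coprimeMr /coprime gcdnn => /andP[/eqP H _].
by have := c1 i; rewrite H.
Qed.

End PairwiseCoprime.

(** * Alternating sums over subsets *)

(** For i outside A, the terms at A and [i |: A] have equal values and opposite signs. *)
Lemma alternating_sum_eq0 (I : finType) (i : I) (F : {set I} -> int) :
  (forall A : {set I}, i \notin A -> F (i |: A) = F A) ->
  \sum_(A : {set I}) (-1) ^+ #|A| * F A = 0.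
Proof.
move=> Fi; rewrite (bigID (fun A : {set I} => i \in A)) /=.
rewrite (reindex_onto (fun A => i |: A) (fun A => A :\ i)) /=; last first.
  by move=> A iA; rewrite setD1K.
rewrite (eq_bigl (fun A : {set I} => i \notin A)) => [|A]; last first.
  rewrite setU11 /=; apply/eqP/idP => [<-|/setU1K //].
  by rewrite !inE eqxx.
rewrite -big_split big1 //= => A iA.
by rewrite Fi // cardsU1 iA exprS mulN1r mulNr addNr.
Qed.

Lemma prod_sign_add (I : finType) (f : I -> int) :
  \prod_i (1 - f i) = \sum_(A : {set I}) (-1) ^+ #|A| * \prod_(i in A) f i.
Proof.
under eq_bigr do rewrite addrC.
rewrite bigA_distr; apply: eq_bigr => A _.
by rewrite -big_mkcond /= prodrN.
Qed.

(** * Greatest-type divisors and their codivisors x / y *)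

Section GreatestTypeDivisors.
Local Open Scope nat_scope.

Lemma greatest_type_divisorsP (S : {fset nat}) (x : nat)
    (y : greatest_type_divisors S x) :
  [/\ val y \in S, val y %| x & val y < x].
Proof. by have := valP y; rewrite !inE /= => /andP[? /and3P[]]. Qed.

(** Take the largest proper divisor of x in S that is a multiple of d: an element of S strictly
    between it and x would be larger. *)
Lemma greatest_type_divisor_above (S : {fset nat}) (x d : nat) :
  0 < x -> d \in S -> d %| x -> d < x ->
  exists y : greatest_type_divisors S x, d %| val y.
Proof.
move=> x0 dS dx dltx.
pose P (e : S) := [&& d %| val e, val e %| x & val e < x].
have Pd : P [` dS] by rewrite /P /= dvdnn dx.
case: (arg_maxnP val Pd) => y /and3P[dy yx yltx] ymax.
suff yG : val y \in greatest_type_divisors S x by exists [` yG].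
rewrite !inE (valP y) yx yltx /=; apply/forallP => e; apply/implyP.
case/andP=> ye ex; have := dvdn_leq x0 ex; rewrite leq_eqVlt.
case/orP=> [->|eltx]; first by rewrite orbT.
have Pe : P e by rewrite /P ex eltx (dvdn_trans dy ye).
have ey : val e <= val y := ymax _ Pe.
by rewrite eqn_leq ey (dvdn_leq (dvdn_gt0 x0 ex) ye).
Qed.

Variables (S : {fset nat}) (x : nat).
Hypotheses (xS : x \in S) (x0 : 0 < x) (S_G : conditionG S).

Local Notation G := (greatest_type_divisors S x).
Local Notation c := (fun y : G => x %/ val y).

Lemma codivisor_gt1 (y : G) : 1 < c y.
Proof.
have [_ yx yltx] := greatest_type_divisorsP y.
by rewrite ltn_divRL // mul1n.
Qed.

Lemma dvdn_codivisor (y : G) : c y %| x.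
Proof. by have [_ yx _] := greatest_type_divisorsP y; apply: dvdn_div. Qed.

Lemma codivisorK (y : G) : x %/ c y = val y.
Proof. by have [_ yx _] := greatest_type_divisorsP y; rewrite divnA // mulKn. Qed.

(** If g is the gcd of x / y and x / z, then y and z divide x / g, hence so does their lcm. By
    condition G this lcm is x, so g = 1. *)
Lemma coprime_codivisors (y z : G) : y != z -> coprime (c y) (c z).
Proof.
move=> yz; have vyz : val y != val z by [].
have card2 : 2 <= #|` G|.
  by rewrite (cardfsD1 (val y)) (valP y) (cardfsD1 (val z)) in_fsetD1 eq_sym vyz
             (valP z).
have [lx _] := S_G xS card2 (valP y) (valP z) vyz.
rewrite /coprime; set g := gcdn _ _.
have gx : g %| x by apply: dvdn_trans (dvdn_gcdl _ _) (dvdn_codivisor y).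
have g0 : 0 < g by apply: dvdn_gt0 gx.
have dvg u : u %| x -> g %| x %/ u -> u %| x %/ g.
  by move=> ux gu; rewrite dvdn_divRL // -[X in _ %| X](divnK ux) mulnC dvdn_mul.
have : lcmn (val y) (val z) %| x %/ g.
  have [_ yx _] := greatest_type_divisorsP y.
  have [_ zx _] := greatest_type_divisorsP z.
  by rewrite dvdn_lcm !dvg ?dvdn_gcdl ?dvdn_gcdr.
rewrite lx => /dvdn_leq; rewrite divn_gt0 // (dvdn_leq x0 gx) => /(_ isT).
by rewrite leq_divRL // -[leqRHS]muln1 leq_pmul2l // eqn_leq g0 andbT.
Qed.

Lemma dvdn_codivisor_prod (A : {set G}) : \prod_(y in A) c y %| x.
Proof.
by move: A; apply: dvdn_prod_coprime coprime_codivisors; apply: dvdn_codivisor.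
Qed.

(** Since y = x / [c y] and [c y] is coprime to the product over A, enlarging A by y amounts to a
    gcd with y. This recursion drives the inductions on A and the cancellation. *)
Lemma div_codivisor_setU1 (y : G) (A : {set G}) : y \notin A ->
  x %/ \prod_(z in y |: A) c z = gcdn (val y) (x %/ \prod_(z in A) c z).
Proof.
move=> yA; rewrite -(codivisorK y) gcdn_div_coprime ?dvdn_codivisor //.
- by rewrite big_setU1.
- by apply: coprime_prod_set => z zA; apply: coprime_codivisors;
     apply: contraNneq yA => ->.
exact: dvdn_codivisor_prod.
Qed.

Lemma div_codivisor_prod_in (A : {set G}) :
  gcd_closed S -> x %/ \prod_(y in A) c y \in S.
Proof.
move=> S_gcd; move: A; apply: set_ind => [|y A yA IH].
  by rewrite big_set0 divn1.
rewrite div_codivisor_setU1 //; apply: S_gcd => //.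
by have [] := greatest_type_divisorsP y.
Qed.

(** The outer gcd with x covers the empty A, where the iterated gcd is 0. *)
Lemma gcdn_greatest_type_divisors (A : {set G}) :
  gcdn x (\big[gcdn/0]_(y in A) val y) = x %/ \prod_(y in A) c y.
Proof.
move: A; apply: set_ind => [|y A yA IH].
  by rewrite !big_set0 gcdn0 divn1.
by rewrite div_codivisor_setU1 // -IH big_setU1 //= gcdnCA.
Qed.

(** * Sums weighted by the imitative Möbius function *)

Local Open Scope ring_scope.

Lemma imitative_mobius1 : imitative_mobius S x 1 = 1.
Proof. by []. Qed.

(** Distinct sets A have distinct products, so at most one term occurs; the empty set gives the
    value 1 at t = 1. In this form sums can be exchanged. *)
Lemma imitative_mobius_sum (t : nat) :
  imitative_mobius S x t =
  \sum_(A : {set G} | \prod_(y in A) c y == t :> nat) (-1) ^+ #|A|.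
Proof.
have cinj := prod_coprime_inj codivisor_gt1 coprime_codivisors.
have muP (A : {set G}) :
    imitative_mobius S x (\prod_(y in A) c y) = (-1) ^+ #|A|.
  have [->|A0] := eqVneq A set0; first by rewrite big_set0 cards0.
  exact: imitative_mobius_prod.
case: (pickP (fun A : {set G} => \prod_(y in A) c y == t)) => [A /eqP <-|nA].
  rewrite muP (big_pred1 A) // => B /=.
  by apply/eqP/eqP => [/cinj|->].
rewrite big_pred0 // /imitative_mobius; case: eqP => [E|_].
  by have := nA set0; rewrite big_set0 E eqxx.
by case: pickP => // A /andP[_]; rewrite eq_sym nA.
Qed.

(** After exchanging the sums, each A selects exactly one d, namely x divided by its product, which
    lies in S by gcd closedness. *)
Lemma sum_imitative_mobius (F : nat -> int) : gcd_closed S ->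
  \sum_(d <- S | (d %| x)%N) imitative_mobius S x (x %/ d) * F d =
  \sum_(A : {set G}) (-1) ^+ #|A| * F (x %/ \prod_(y in A) c y)%N.
Proof.
move=> S_gcd; under eq_bigr do rewrite imitative_mobius_sum mulr_suml.
rewrite (exchange_big_dep predT) //=; apply: eq_bigr => A _.
set P := (\prod_(y in A) _)%N.
have PS : (x %/ P)%N \in S := div_codivisor_prod_in A S_gcd.
have Px : (P %| x)%N := dvdn_codivisor_prod A.
rewrite big_seq_fsetE (big_pred1 [` PS]) // => d /=.
rewrite -val_eqE /=; apply/andP/eqP => [[dx /eqP ->]|->].
  by rewrite divnA // mulKn.
by rewrite dvdn_div // divnA // mulKn.
Qed.

(** [F] is arbitrary so that both the gcd and the lcm matrices are covered. *)
Lemma sum_imitative_mobius_eq0 (F : nat -> int) (z : nat) :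
  gcd_closed S -> z \in S -> ~~ (x %| z)%N ->
  \sum_(d <- S | (d %| x)%N) imitative_mobius S x (x %/ d) * F (gcdn z d) = 0.
Proof.
move=> S_gcd zS nxz.
have gltx : (gcdn z x < x)%N.
  rewrite ltn_neqAle (dvdn_leq x0 (dvdn_gcdr _ _)) andbT.
  by apply: contraNneq nxz => <-; apply: dvdn_gcdl.
have [y gy] := greatest_type_divisor_above x0 (S_gcd _ _ zS xS)
                 (dvdn_gcdr _ _) gltx.
rewrite (@sum_imitative_mobius (fun d => F (gcdn z d))) //.
apply: (alternating_sum_eq0 (i := y)) => A yA.
(* The gcd of z with a divisor of x divides gcd(z, x), hence y, so the extra gcd with y is
   absorbed. *)
rewrite div_codivisor_setU1 // gcdnCA; congr F; apply/gcdn_idPr.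
apply: dvdn_trans gy; rewrite dvdn_gcd dvdn_gcdl /=.
by apply: dvdn_trans (dvdn_gcdr _ _) (dvdn_div (dvdn_codivisor_prod A)).
Qed.

Lemma sum_imitative_mobius_expn (a : nat) : gcd_closed S -> x != 1%N ->
  (1%N \in S) ->
  \sum_(d <- S | (d %| x)%N) imitative_mobius S x (x %/ d) * d%:Z ^+ a =
  (\big[gcdn/0%N]_(y <- G) y)%:Z ^+ a *
  \prod_(y <- G) ((x %/ y)%N%:Z ^+ a - 1).
Proof.
move=> S_gcd x1 S1.
(* G is nonempty because 1 is in S and x is not 1; an empty iterated gcd would be 0. *)
have [y0 _] : exists y : G, (1 %| val y)%N.
  by apply: greatest_type_divisor_above; rewrite ?dvd1n // ltn_neqAle eq_sym x1.
have inT : [in [set: G]] =1 predT by move=> y; rewrite inE.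
have -> : (\big[gcdn/0]_(y <- G) y = x %/ \prod_(y : G) c y)%N.
  rewrite -(eq_bigl _ _ inT) -gcdn_greatest_type_divisors (eq_bigl _ _ inT).
  rewrite big_seq_fsetE; apply/esym/gcdn_idPr; rewrite (bigD1 y0) //=.
  by apply: dvdn_trans (dvdn_gcdl _ _) _; have [] := greatest_type_divisorsP y0.
rewrite (sum_imitative_mobius (fun d => d%:Z ^+ a)) // big_seq_fsetE /=.
(* With -1 as first summand, A collects the factors -1 in the expansion. *)
under [X in _ = _ * X]eq_bigr do rewrite addrC.
rewrite bigA_distr mulr_sumr; apply: eq_bigr => A _.
rewrite big_if /= prodr_const.
rewrite mulrCA prodrXl -exprMn; congr (_ * _ ^+ a).
have := dvdn_codivisor_prod setT.
rewrite (eq_bigl _ _ inT) => Tx.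
rewrite -(big_morph _ PoszM (erefl _)) -PoszM; congr Posz.
move: Tx; rewrite (bigID (mem A)) /=.
set P := (\prod_(y in A) _)%N; set Q := (\prod_(y | y \notin A) _)%N.
(* Here x = k P Q, so x / P = k Q, where k is the gcd of all of G. *)
move=> /dvdnP[k Ek]; move: x0; rewrite {1 2 3}Ek !muln_gt0 => /and3P[k0 P0 Q0].
by rewrite mulnK ?muln_gt0 ?P0 // mulnCA mulKn // mulnC.
Qed.

(** At d = x / P the quotient x / d is the product P itself, so the sum is the expansion of the
    right-hand side. *)
Lemma sum_imitative_mobius_div_expn (a : nat) : gcd_closed S ->
  \sum_(d <- S | (d %| x)%N) imitative_mobius S x (x %/ d) * (x %/ d)%N%:Z ^+ a =
  \prod_(y <- G) (1 - (x %/ y)%N%:Z ^+ a).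
Proof.
move=> S_gcd; rewrite (sum_imitative_mobius (fun d => (x %/ d)%N%:Z ^+ a)) //.
rewrite big_seq_fsetE prod_sign_add /=; apply: eq_bigr => A _.
rewrite divnA ?dvdn_codivisor_prod // mulKn //.
by rewrite (big_morph _ PoszM (erefl _)) prodrXl.
Qed.

End GreatestTypeDivisors.

(** * Congruence to a diagonal matrix *)

(** A nonzero term [B k i * (M *m B) k j] needs x_j | x_k | x_i. Symmetry and injectivity leave only
    i = j, and then only k = i. *)
Lemma congruence_diag_mx (R : comPzRingType) (n : nat) (x : 'I_n -> nat)
    (B M : 'M[R]_n) :
  injective x -> M^T = M ->
  (forall i j, ~~ (x i %| x j)%N -> B i j = 0) -> (forall i, B i i = 1) ->
  (forall i j, ~~ (x j %| x i)%N -> (M *m B) i j = 0) ->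
  B^T *m M *m B = diag_mx (\row_i (M *m B) i i).
Proof.
move=> x_inj MT Bdvd B1 MBdvd; set D := _ *m M *m B.
have DT : D^T = D by rewrite /D !trmx_mul trmxK MT mulmxA.
have DE i j : D i j = \sum_k B k i * (M *m B) k j.
  by rewrite /D -mulmxA mxE; apply: eq_bigr => k _; rewrite mxE.
have Dij i j : ~~ (x j %| x i)%N -> D i j = 0.
  move=> nji; rewrite DE big1 // => k _.
  have [kj|/MBdvd ->] := boolP (x j %| x k)%N; last by rewrite mulr0.
  rewrite Bdvd ?mul0r //; apply: contra nji; exact: dvdn_trans.
apply/matrixP => i j; rewrite [RHS]mxE [X in _ = X *+ _]mxE.
have [<-|nij] := eqVneq i j.
  rewrite mulr1n DE (bigD1 i) //= B1 mul1r big1 ?addr0 // => k ki.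
  have [ik|/MBdvd ->] := boolP (x i %| x k)%N; last by rewrite mulr0.
  rewrite Bdvd ?mul0r //; apply: contra_neqN ki => ki.
  by apply: x_inj; apply/eqP; rewrite eqn_dvd ki.
rewrite mulr0n.
have [ji|/Dij //] := boolP (x j %| x i)%N.
rewrite -DT [LHS]mxE Dij //; apply: contra_neqN nij => ij.
by apply: x_inj; apply/eqP; rewrite eqn_dvd ij.
Qed.

Theorem theorem4p1 (a n : nat) (ha : (0 < a)%N) (hn : (0 < n)%N)
    (S : {fset nat}) (x : 'I_n -> nat)
    (x_pos : forall i, (0 < x i)%N)
    (x_inj : injective x)
    (S_x : S = [fset x i | i : 'I_n])
    (S_gcd : gcd_closed S)
    (S_G : conditionG S)
    (x_gcd : \big[gcdn/0%N]_(i < n) x i = 1%N)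
    (x_1 : x (Ordinal hn) = 1%N) :
  (B_mx S x)^T *m power_gcd_mx x a *m B_mx S x =
    diag_mx (\row_(i < n)
      if i == Ordinal hn then 1
      else (\big[gcdn/0%N]_(y <- greatest_type_divisors S (x i)) y)%:Z ^+ a *
           \prod_(y <- greatest_type_divisors S (x i)) ((x i %/ y)%N%:Z ^+ a - 1)) /\
  (B_pow_mx S x a)^T *m power_lcm_mx x a *m B_pow_mx S x a =
    diag_mx (\row_(i < n)
      if i == Ordinal hn then 1
      else (x i)%:Z ^+ a *
           \prod_(y <- greatest_type_divisors S (x i)) (1 - (x i %/ y)%N%:Z ^+ a)).
Proof.
have xS i : x i \in S by rewrite S_x; apply/imfsetP; exists i.
have sumS (P : pred nat) (F : nat -> int) :
    \sum_(d <- S | P d) F d = \sum_(i | P (x i)) F (x i).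
  rewrite S_x big_mkcond big_imfset /=; last by move=> i j _ _ /x_inj.
  by rewrite [RHS]big_mkcond big_enum.
have colG i j : (power_gcd_mx x a *m B_mx S x) i j =
    \sum_(d <- S | (d %| x j)%N)
      imitative_mobius S (x j) (x j %/ d) * (gcdn (x i) d)%:Z ^+ a.
  rewrite sumS mxE [RHS]big_mkcond /=; apply: eq_bigr => k _.
  by rewrite !mxE; case: ifP => _; rewrite ?mulr0 // mulrC.
(* Absorbing (x_j / d)^a into the lcm leaves a function of gcd(x_i, d), as the vanishing lemma
   requires. *)
have colL i j : (power_lcm_mx x a *m B_pow_mx S x a) i j =
    \sum_(d <- S | (d %| x j)%N) imitative_mobius S (x j) (x j %/ d) *
      (x i * x j %/ gcdn (x i) d)%N%:Z ^+ a.
  rewrite sumS mxE [RHS]big_mkcond /=; apply: eq_bigr => k _.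
  rewrite !mxE; case: ifP => kj; last by rewrite mulr0.
  rewrite mulrC -mulrA -exprMn -PoszM; congr (_ * Posz _ ^+ a).
  have g0 : (0 < gcdn (x i) (x k))%N by rewrite gcdn_gt0 x_pos.
  apply/eqP; rewrite -(eqn_pmul2r g0) divnK ?dvdn_mulr ?dvdn_gcdl //.
  by rewrite -mulnA muln_lcm_gcd mulnCA divnK.
have x1 i : i != Ordinal hn -> x i != 1%N.
  by apply: contra_neq; rewrite -x_1 => /x_inj.
have S1 : 1%N \in S by rewrite -x_1.
have sym f : commutative f ->
    (\matrix_(i, j) (f (x i) (x j))%:Z ^+ a)^T =
    \matrix_(i, j) (f (x i) (x j))%:Z ^+ a :> 'M[int]_n.
  by move=> fC; apply/matrixP => i j; rewrite !mxE fC.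
(* This yields the first diagonal entry directly; the general gcd formula would involve an empty gcd
   there. *)
have sum1 (F : nat -> int) : \sum_(d <- S | (d %| 1)%N) F d = F 1%N.
  rewrite sumS (big_pred1 (Ordinal hn)) ?x_1 // => k /=.
  by rewrite dvdn1 -x_1 (inj_eq x_inj).
split.
  rewrite (congruence_diag_mx x_inj) ?(sym _ gcdnC) //.
  - congr diag_mx; apply/rowP => i; rewrite [LHS]mxE [RHS]mxE.
    rewrite colG; case: eqP => [->|/eqP/x1 xi1].
      by rewrite x_1 sum1 gcdnn expr1n mulr1 imitative_mobius1.
    rewrite -sum_imitative_mobius_expn //.
    by apply: eq_bigr => d di; rewrite (gcdn_idPr di).
  - by move=> i j /negPf nij; rewrite mxE nij.
  - by move=> i; rewrite mxE dvdnn divnn x_pos.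
  move=> i j nji; rewrite colG.
  by apply: (sum_imitative_mobius_eq0 (xS j) (x_pos j) S_G
           (fun d => d%:Z ^+ a)) => //.
rewrite (congruence_diag_mx x_inj) ?(sym _ lcmnC) //.
- congr diag_mx; apply/rowP => i; rewrite [LHS]mxE [RHS]mxE.
  rewrite colL; case: eqP => [->|_].
    by rewrite x_1 sum1 gcdnn divn1 expr1n mulr1 imitative_mobius1.
  (* For d | x_i, x_i x_i / gcd(x_i, d) = x_i (x_i / d), which releases the factor x_i^a. *)
  rewrite -sum_imitative_mobius_div_expn // mulr_sumr; apply: eq_bigr => d di.
  by rewrite (gcdn_idPr di) -muln_divA // PoszM exprMn mulrCA.
- by move=> i j /negPf nij; rewrite mxE nij.
- by move=> i; rewrite mxE dvdnn divnn x_pos expr1n mulr1.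
move=> i j nji; rewrite colL.
by apply: (sum_imitative_mobius_eq0 (xS j) (x_pos j) S_G
           (fun d => (x i * x j %/ d)%N%:Z ^+ a)) => //.
Qed.
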